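(* Let $D,P,P'\in\mathbb{N}$ and let $S\subseteq\mathbb{R}^D$ be compact. For each $N\in\mathbb{N}$ let $\hat{\boldsymbol\theta}_N$ be a random element of $C(S,\mathbb{R}^P)$ (an estimator), and let $\boldsymbol\theta\in C(S,\mathbb{R}^P)$ be a (deterministic) parameter, such that as $N\to\infty$ $$\sqrt{N}\,\big(\hat{\boldsymbol\theta}_N-\boldsymbol\theta\big)\rightsquigarrow \boldsymbol G\quad\text{weakly in } C(S,\mathbb{R}^P),$$ where $\boldsymbol G$ is a zero-mean Gaussian process on $C(S,\mathbb{R}^P)$ with covariance function $\boldsymbol{\mathfrak c}(s,s')=\mathbb{E}[\boldsymbol G(s)\boldsymbol G(s')^T]\in\mathbb{R}^{P\times P}$. Let $H\in C^1(\mathbb{R}^P,\mathbb{R}^{P'})$. Then: (a) As $N\to\infty$, $$\sqrt N\,\big(H(\hat{\boldsymbol\theta}_N)-H(\boldsymbol\theta)\big)\rightsquigarrow \tilde{\boldsymbol G}:=\mathrm{d}H_{\boldsymbol\theta}\boldsymbol G\quad\text{weakly in } C(S,\mathbb{R}^{P'}),$$ and $\tilde{\boldsymbol G}$ is a zero-mean Gaussian process with covariance $\tilde{\boldsymbol{\mathfrak c}}(s,s')=\mathrm{d}H_{\boldsymbol\theta(s)}\,\boldsymbol{\mathfrak c}(s,s')\,\mathrm{d}H_{\boldsymbol\theta(s')}^T$. (b) If $\{\boldsymbol R_{N,n}: N\in\mathbb{N},\,1\le n\le N\}$ is a triangular array of random processes in $C(S,\mathbb{R}^P)$ (defined on the same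 probability space as the $\hat{\boldsymbol\theta}_N$) such that $\sum_{n=1}^N\boldsymbol R_{N,n}=0$ for every $N$ and $$\lim_{N\to\infty}N^{-1}\sum_{n=1}^N\boldsymbol R_{N,n}(s)\,\boldsymbol R_{N,n}^T(s')=\boldsymbol{\mathfrak c}(s,s')$$ uniformly (over $(s,s')\in S\times S$) in probability, then the functional delta residuals $\tilde{\boldsymbol R}_{N,n}(s)=\mathrm{d}H_{\hat{\boldsymbol\theta}_N(s)}\boldsymbol R_{N,n}(s)$, $n=1,\dots,N$, satisfy $$\lim_{N\to\infty}N^{-1}\sum_{n=1}^N\tilde{\boldsymbol R}_{N,n}(s)\,\tilde{\boldsymbol R}_{N,n}^T(s')=\tilde{\boldsymbol{\mathfrak c}}(s,s')$$ uniformly (over $(s,s')\in S\times S$) in probability, and $\sum_{n=1}^N\tilde{\boldsymbol R}_{N,n}=0$.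
   Context: $C(S,\mathbb{R}^P)$ is the Banach space of continuous functions $S\to\mathbb{R}^P$ with the maximum norm $\|f\|_\infty=\max_{s\in S}|f(s)|$; $\rightsquigarrow$ denotes weak convergence in this space. For $x\in\mathbb{R}^P$, $\mathrm{d}H_x\in\mathbb{R}^{P'\times P}$ denotes the derivative (Jacobian) of $H$ at $x$. $H(\boldsymbol\theta)$ denotes $s\mapsto H(\boldsymbol\theta(s))$ and $\mathrm{d}H_{\boldsymbol\theta}\boldsymbol G$ denotes $s\mapsto \mathrm{d}H_{\boldsymbol\theta(s)}\boldsymbol G(s)$. *)

(* Defs.v *)
From HB Require Import structures.
From mathcomp Require Import all_boot all_order all_algebra.
From mathcomp Require Import all_classical all_reals all_analysis.

Set Implicit Arguments.
Unset Strict Implicit.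
Unset Printing Implicit Defensive.

Import Order.TTheory GRing.Theory Num.Theory.
Import numFieldNormedType.Exports.

Local Open Scope classical_set_scope.
Local Open Scope ring_scope.

(** R^n is ['rV[R]_n], with the library's norm; vectors are rows, so the
    product [x y^T] of column vectors is [x^T *m y] here. A set [S] is used as a
    type through [set_type], with the topology induced by R^D. *)

Definition cfun_pred (R : realType) (D P : nat) (S : set 'rV[R]_D) :
    {pred S -> 'rV[R]_P} :=
  fun f => `[< continuous f >].
Arguments cfun_pred : clear implicits.

(** C(S, R^P). The compactness proof is a parameter of the type because the
    maximum norm below is only a norm when [S] is compact. *)
Record Cspace (R : realType) (D : nat) (S : set 'rV[R]_D) (cS : compact S)
    (P : nat) : Type := MkCspace {
  cfun_val :> S -> 'rV[R]_P ;
  cfun_valP : cfun_val \in cfun_pred R D P S }.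

Section Cspace_lmodule.
Context (R : realType) (D P : nat) (S : set 'rV[R]_D) (cS : compact S).

HB.instance Definition _ := [isSub for (@cfun_val R D S cS P)].
HB.instance Definition _ := [Choice of Cspace cS P by <:].

Lemma cfun_continuous (f : Cspace cS P) : continuous f.
Proof. by have := cfun_valP f => /asboolP. Qed.

Definition mkC (f : S -> 'rV[R]_P) (cf : continuous f) : Cspace cS P :=
  MkCspace cS (asboolT cf : f \in cfun_pred R D P S).

Lemma cfun_submod_closed : submod_closed (cfun_pred R D P S).
Proof.
split; first by apply/asboolP => x; exact: cst_continuous.
move=> a f g /asboolP cf /asboolP cg; apply/asboolP => x.
apply: (@continuousD _ _ _ (a \*: f) g); last exact: cg.
by apply: continuousZr; exact: cf.
Qed.

HB.instance Definition _ :=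
  GRing.isSubmodClosed.Build R (S -> 'rV[R]_P) (cfun_pred R D P S)
    cfun_submod_closed.
HB.instance Definition _ := [SubChoice_isSubLmodule of Cspace cS P by <:].

End Cspace_lmodule.

Section Cspace_normed.
Context (R : realType) (D P : nat) (S : set 'rV[R]_D) (cS : compact S).
Implicit Types f g : Cspace cS P.

Lemma cfunE f g (a : R) (s : S) :
  ((f + g) s = f s + g s) * ((- f) s = - f s) * ((a *: f) s = a *: f s) *
  ((0 : Cspace cS P) s = 0).
Proof. by []. Qed.

Lemma cfunP f g : (forall s, f s = g s) -> f = g.
Proof. by move=> fg; apply: val_inj; apply/funext. Qed.

(** The supremum is a maximum if [S] is nonempty, and is 0 if [S] is empty. *)
Definition cfun_norm f : R := sup [set `|f s| | s in [set: S]].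

Lemma cfun_norm_has_ubound f : has_ubound [set `|f s| | s in [set: S]].
Proof.
have cf : {within S, continuous (valL f)}.
  exact/subspace_valL_continuousP/cfun_continuous.
have /compact_bounded[M [_ Mf]] := continuous_compact cf cS.
exists (M + 1) => _ [s _ <-]; apply: Mf; first by rewrite ltrDl.
exists (set_val s); first exact: set_valP.
by have /(congr1 (@^~ s)) := valLK point f.
Qed.

Lemma cfun_norm_ub f s : `|f s| <= cfun_norm f.
Proof. by apply: ub_le_sup; [exact: cfun_norm_has_ubound | exists s]. Qed.

Lemma cfun_norm_le f (M : R) :
  0 <= M -> (forall s, `|f s| <= M) -> cfun_norm f <= M.
Proof.
move=> M0 fM; rewrite /cfun_norm.
have [[r Ar]|/set0P/negP/negPn/eqP ->] := pselect ([set `|f s| | s in [set: S]] !=set0).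
  by apply: ge_sup; [exists r | move=> _ [s _ <-]].
by rewrite sup0.
Qed.

Lemma cfun_norm_ge0 f : 0 <= cfun_norm f.
Proof.
have [[_ [s _ _]]|/set0P/negP/negPn/eqP E] := pselect ([set `|f s| | s in [set: S]] !=set0).
  exact: le_trans (cfun_norm_ub f s).
by rewrite /cfun_norm E sup0.
Qed.

Lemma cfun_normD f g : cfun_norm (f + g) <= cfun_norm f + cfun_norm g.
Proof.
apply: cfun_norm_le; first by rewrite addr_ge0 ?cfun_norm_ge0.
by move=> s; apply: le_trans (ler_normD _ _) _; rewrite lerD ?cfun_norm_ub.
Qed.

Lemma cfun_normZ (a : R) f : cfun_norm (a *: f) = `|a| * cfun_norm f.
Proof.
have le b h : cfun_norm (b *: h) <= `|b| * cfun_norm h.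
  apply: cfun_norm_le; first by rewrite mulr_ge0 ?cfun_norm_ge0.
  by move=> s; rewrite cfunE// normrZ ler_wpM2l ?cfun_norm_ub.
apply/eqP; rewrite eq_le le /=.
have [->|a0] := eqVneq a 0; first by rewrite normr0 mul0r cfun_norm_ge0.
rewrite -ler_pdivlMl ?normr_gt0// -normfV.
by apply: le_trans (le _ _); rewrite scalerA mulVf// scale1r.
Qed.

Lemma cfun_norm0_eq0 f : cfun_norm f = 0 -> f = 0.
Proof.
move=> f0; apply: cfunP => s; apply/normr0_eq0/eqP.
by rewrite eq_le normr_ge0 andbT -f0 cfun_norm_ub.
Qed.

HB.instance Definition _ :=
  @Lmodule_isNormed.Build R (Cspace cS P) cfun_norm
    cfun_normD cfun_normZ cfun_norm0_eq0.

(** The Borel sigma-algebra of the norm topology. *)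
HB.instance Definition _ := Measurable.copy (Cspace cS P)
  (g_sigma_algebraType (@open (Cspace cS P))).
End Cspace_normed.


(** C^1(R^P, R^P'). *)
Record C1map (R : realType) (P P' : nat) := MkC1map {
  C1fun :> 'rV[R]_P -> 'rV[R]_P' ;
  C1_differentiable : forall x, differentiable C1fun x ;
  C1_continuous : continuous (fun x => 'J C1fun x) }.

(** The usual P' x P Jacobian matrix: since vectors are rows, ['J H x] of the
    library is its transpose, and ['d H x v = v *m 'J H x]. *)
Definition dmx (R : realType) (P P' : nat) (H : C1map R P P') (x : 'rV[R]_P) :
  'M[R]_(P', P) := ('J H x)^T.

Section operators.
Context (R : realType) (D P P' : nat) (S : set 'rV[R]_D) (cS : compact S).
Variable H : C1map R P P'.

Lemma diffEjacobian (x v : 'rV[R]_P) : 'd H x v = v *m 'J H x.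
Proof. by rewrite /jacobian mul_rV_lin1. Qed.

Lemma cfun_comp_continuous (f : Cspace cS P) : continuous (fun s => H (f s)).
Proof.
move=> s; apply: (@continuous_comp _ _ _ f H); first exact: cfun_continuous.
exact/differentiable_continuous/C1_differentiable.
Qed.

(** [H(f)], i.e. [s |-> H (f s)]. *)
Definition cfun_comp (f : Cspace cS P) : Cspace cS P' :=
  mkC cS (@cfun_comp_continuous f).

Lemma mx_entry_continuous (T : topologicalType) m n (A : T -> 'M[R]_(m, n)) :
  (forall i j, continuous (fun t => A t i j)) -> continuous A.
Proof.
move=> cA t B [C CA sCB]; apply: (@filterS _ (nbhs t) _
    [set u | forall i j, C i j (A u i j)]).
  by move=> u Cu; exact: sCB.
apply: filter_forall => i; apply: filter_forall => j.
exact: (cA i j t _ (CA i j)).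
Qed.

Lemma cfun_diff_continuous (f g : Cspace cS P) :
  continuous (fun s => 'd H (f s) (g s)).
Proof.
apply: mx_entry_continuous => i j.
under eq_fun do rewrite diffEjacobian mxE.
apply: continuous_big => [|k _ s]; first exact: add_continuous.
apply: (@continuousM _ _ (fun s => g s i k) (fun s => 'J H (f s) k j)).
  apply: (@continuous_comp _ _ _ g (fun v : 'rV[R]_P => v i k)).
    exact: cfun_continuous.
  exact: coord_continuous.
apply: (@continuous_comp _ _ _ (fun s => 'J H (f s))
          (fun v : 'M[R]_(P, P') => v k j)); last exact: coord_continuous.
apply: (@continuous_comp _ _ _ f (fun x => 'J H x)).
  exact: cfun_continuous.
exact: C1_continuous.
Qed.

(** [dH_f g], i.e. [s |-> dH_(f s) (g s)]. *)
Definition cfun_diff (f g : Cspace cS P) : Cspace cS P' :=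
  mkC cS (@cfun_diff_continuous f g).

End operators.

(** Weak convergence in C(S, R^P) of random elements, each living on its own
    probability space. *)
Definition weakly_cvg (R : realType) (D P : nat) (S : set 'rV[R]_D)
    (cS : compact S)
    (d : nat -> measure_display) (Omega : forall N, measurableType (d N))
    (Pr : forall N, probability (Omega N) R)
    (X : forall N, Omega N -> Cspace cS P)
    (d' : measure_display) (Omega' : measurableType d')
    (Pr' : probability Omega' R) (Y : Omega' -> Cspace cS P) : Prop :=
  [/\ forall N, measurable_fun [set: Omega N] (X N),
      measurable_fun [set: Omega'] Y &
      forall F : Cspace cS P -> R, continuous F -> bounded_fun F ->
        'E_(Pr N)[F \o X N]%E @[N --> \oo] --> 'E_Pr'[F \o Y]%E ].

(** The normal law with mean [m] and standard deviation [sigma]. The degenerate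
    case is separate because [normal_prob m 0] is a uniform law. *)
Definition normal_law (R : realType) (m sigma : R) (A : set R) : \bar R :=
  if sigma == 0 then \d_m A else normal_prob m sigma A.

Definition gaussian_rv (d : measure_display) (Omega : measurableType d)
    (R : realType) (Pr : probability Omega R) (Y : Omega -> R) : Prop :=
  measurable_fun [set: Omega] Y /\
  exists m sigma : R, forall A : set R, measurable A ->
    Pr (Y @^-1` A) = normal_law m sigma A.

(** All finite-dimensional distributions are jointly Gaussian (possibly
    degenerate), i.e. every linear combination of the coordinates of
    [X(s_1), .., X(s_n)] is a Gaussian variable. *)
Definition gaussian_process (R : realType) (D P : nat) (S : set 'rV[R]_D)
    (cS : compact S) (d : measure_display) (Omega : measurableType d)
    (Pr : probability Omega R) (X : Omega -> Cspace cS P) : Prop :=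
  measurable_fun [set: Omega] X /\
  forall (n : nat) (s : 'I_n -> S) (a : 'I_n -> 'rV[R]_P),
    gaussian_rv Pr (fun w => \sum_(k < n) \sum_(i < P) a k 0 i * X w (s k) 0 i).

Definition zero_mean (R : realType) (D P : nat) (S : set 'rV[R]_D)
    (cS : compact S) (d : measure_display) (Omega : measurableType d)
    (Pr : probability Omega R) (X : Omega -> Cspace cS P) : Prop :=
  forall (s : S) (i : 'I_P), 'E_Pr[(fun w => X w s 0 i)%R]%E = 0%E.

(** [c(s, s') = E[X(s) X(s')^T]] for a zero-mean process [X]. *)
Definition has_covariance (R : realType) (D P : nat) (S : set 'rV[R]_D)
    (cS : compact S) (d : measure_display) (Omega : measurableType d)
    (Pr : probability Omega R) (X : Omega -> Cspace cS P)
    (c : S -> S -> 'M[R]_P) : Prop :=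
  forall (s s' : S) (i j : 'I_P),
    'E_Pr[(fun w => ((X w s)^T *m X w s') i j)%R]%E = (c s s' i j)%:E.

Definition zero_mean_gaussian_process (R : realType) (D P : nat)
    (S : set 'rV[R]_D) (cS : compact S) (d : measure_display)
    (Omega : measurableType d) (Pr : probability Omega R)
    (X : Omega -> Cspace cS P) (c : S -> S -> 'M[R]_P) : Prop :=
  [/\ gaussian_process Pr X, zero_mean Pr X & has_covariance Pr X c].

(** [N^-1 \sum_n R_{N,n}(s) R_{N,n}(s')^T] for a row [r] of the array. *)
Definition sample_cov (R : realType) (D P : nat) (S : set 'rV[R]_D)
    (cS : compact S) (N : nat) (r : 'I_N -> Cspace cS P) (s s' : S) :
    'M[R]_P :=
  N%:R^-1 *: \sum_(n < N) (r n s)^T *m r n s'.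

(** Uniform convergence in probability over S x S. The outer measure [mu^*]
    coincides with the probability on measurable events; it is used so that the
    definition makes sense before the measurability of the supremum over
    S x S is known. *)
Definition cvg_unif_in_prob (R : realType) (D P : nat) (S : set 'rV[R]_D)
    (d : nat -> measure_display) (Omega : forall N, measurableType (d N))
    (Pr : forall N, probability (Omega N) R)
    (A : forall N, Omega N -> S -> S -> 'M[R]_P) (c : S -> S -> 'M[R]_P) :
    Prop :=
  forall eps : R, 0 < eps ->
    mu_ext (Pr N) [set w | exists s s' : S, eps < `|A N w s s' - c s s'|]
      @[N --> \oo] --> 0%E.

(* Main.v *)
Require Import Defs.
From HB Require Import structures.
From mathcomp Require Import all_boot all_order all_algebra.
From mathcomp Require Import all_classical all_reals all_analysis.
From mathcomp Require Import measurable_realfun lra.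
Set Implicit Arguments.
Unset Strict Implicit.
Unset Printing Implicit Defensive.
Import Order.TTheory GRing.Theory Num.Theory.
Import numFieldNormedType.Exports.
Local Open Scope classical_set_scope.
Local Open Scope ring_scope.

(** Write [X_N = sqrt N (thetahat_N - theta)]. Because [theta] has compact range
    and [H] is C^1, the first-order Taylor remainder of [H] at [theta s] is small
    relative to the increment, uniformly in [s] ([C1_taylor]). Hence
    [sqrt N (H(thetahat_N) - H(theta))] differs from [dH_theta X_N] by a quantity
    that tends to 0 uniformly over each ball [|X_N| <= M] ([delta_remainder]).
    The law of [X_N] puts almost all its mass on such a ball
    ([weakly_cvg_tight]), so the two sequences are close in probability. Now
    [dH_theta] is a bounded linear operator on continuous functions, so
    [dH_theta X_N] converges weakly to [dH_theta G] by continuous mapping, and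
    closeness in probability transfers this limit ([weakly_cvg_close]).

    That last transfer is immediate for Lipschitz test functions only: a merely
    continuous function on an infinite-dimensional space need not be uniformly
    continuous on balls. The passage from Lipschitz to continuous test functions
    ([weakly_cvg_lipschitz]) uses that a bounded continuous [F] is the increasing
    limit of its Lipschitz envelopes [x |-> inf_y (F y + k |x - y|)]
    ([lipschitz_minorants]), together with dominated convergence for the limit
    law.

    The limit [dH_theta G] is Gaussian since pairing it with [a] amounts to
    pairing [G] with the transpose of [dH_theta] applied to [a]; its mean and
    covariance follow from linearity of expectation, where the integrability
    needed comes from finiteness of the variances of [G].

    For the residuals, the sample covariance is exactly sandwiched between
    Jacobians at [thetahat_N] ([sample_cov_diff]). As [thetahat_N] tends to
    [theta] uniformly in probability ([estimator_consistent]) and the Jacobian is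
    uniformly continuous near the range of [theta], all three factors converge
    uniformly in probability; the product then converges because the limits are
    bounded. The covariance [c] is bounded as a uniform limit of bounded sample
    covariances ([cvg_unif_in_prob_witness]). *)

(** * The maximum norm on matrices *)

Lemma mx_entry_le_norm (R : realType) m n (A : 'M[R]_(m, n)) i j :
  `|A i j| <= `|A|.
Proof.
rewrite [`|A|]mx_normrE; exact: (le_bigmax _ (fun ij => `|A ij.1 ij.2|) (i, j)).
Qed.

Lemma mx_norm_le (R : realType) m n (A : 'M[R]_(m, n)) (M : R) :
  0 <= M -> (forall i j, `|A i j| <= M) -> `|A| <= M.
Proof.
by move=> M0 AM; rewrite [`|A|]mx_normrE; apply: bigmax_le => // -[i j] _; exact: AM.
Qed.

(** Each entry of the product is a sum of [n] products of entries, whence the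
    factor [n] for the entrywise maximum norm. *)
Lemma mx_norm_mulmx_le (R : realType) m n p (A : 'M[R]_(m, n)) (B : 'M[R]_(n, p)) :
  `|A *m B| <= n%:R * `|A| * `|B|.
Proof.
apply: mx_norm_le => [|i j]; first by rewrite !mulr_ge0.
rewrite mxE (le_trans (ler_norm_sum _ _ _))//.
rewrite -mulrA -[X in X%:R * _]card_ord mulr_natl -sumr_const ler_sum// => k _.
by rewrite normrM ler_pM// mx_entry_le_norm.
Qed.

Lemma mx_norm_tr (R : realType) m n (A : 'M[R]_(m, n)) : `|A^T| = `|A|.
Proof.
apply/eqP; rewrite eq_le; apply/andP; split; apply: mx_norm_le => // i j.
  by rewrite mxE mx_entry_le_norm.
by have := mx_entry_le_norm A^T j i; rewrite mxE.
Qed.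

(** * Uniform estimates near the compact range of a continuous function *)

Lemma cfun_range_compact (R : realType) (D P : nat) (S : set 'rV[R]_D)
    (cS : compact S) (f : Cspace cS P) : compact (range f).
Proof.
have -> : range f = valL f @` S.
  have valLf s : valL f (set_val s) = f s by rewrite -[RHS](congr1 (@^~ s) (valLK point f)).
  apply/seteqP; split=> [_ [s _ <-]|_ [x Sx <-]].
    by exists (set_val s); [exact: set_valP|exact: valLf].
  by exists (SigSub (mem_set Sx)) => //; rewrite -valLf.
have cf : {within S, continuous (valL f)}.
  exact/subspace_valL_continuousP/cfun_continuous.
exact: continuous_compact cf cS.
Qed.

(** Heine's theorem relative to a compact set: only one of the two points has
    to lie in the range of [f], so that values of an estimator near [f] are
    covered too. *)
Lemma uniform_continuity_near_range (R : realType) (D P : nat) (S : set 'rV[R]_D)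
    (cS : compact S) (f : Cspace cS P) (W : normedModType R) (g : 'rV[R]_P -> W)
    (eps : R) :
  continuous g -> 0 < eps ->
  exists2 delta, 0 < delta &
    forall s y, `|y - f s| < delta -> `|g y - g (f s)| <= eps.
Proof.
move=> cg e0.
have /compact_near_coveringP/(_ _ 0^'+ (fun delta x =>
   forall y, `|y - x| < delta -> `|g y - g x| <= eps)) := (@cfun_range_compact _ _ _ _ _ f).
move=> /(_ _) [].
  move=> x _.
  have e20 : 0 < eps / 2 by rewrite divr_gt0.
  have /cvgrPdist_lt /(_ _ e20) := cg x.
  move=> /nbhs_normP [/= r r0 gr].
  (* [y] and the point [z] of the range both lie within [r] of [x]: compare through [g x] *)
  exists (ball x (r / 2), [set t : R | t < r / 2]).
    split; first by apply: nbhsx_ballx; rewrite divr_gt0.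
    by apply: nbhs_right_lt; rewrite divr_gt0.
  move=> [z t] /= [xz tr] y yz.
  have {}xz : `|x - z| < r / 2 by rewrite -ball_normE in xz.
  rewrite -(subrKA (g x)) (le_trans (ler_normD _ _))// (splitr eps).
  apply: lerD; apply: ltW; [rewrite distrC|]; apply: gr => /=.
    rewrite -(subrKA z) (le_lt_trans (ler_normD _ _))// (splitr r) ltrD//.
    by rewrite distrC (lt_trans yz).
  by rewrite (lt_trans xz)// gtr_pMr// invf_lt1// ltr1n.
move=> delta0 /= d00 near0.
exists (delta0 / 2) => //; first by rewrite divr_gt0.
move=> s y ys.
apply: (near0 (delta0/2)) => //=.
- by rewrite /ball_/= sub0r normrN gtr0_norm ?divr_gt0// gtr_pMr// invf_lt1// ltr1n.
- by rewrite divr_gt0.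
- by exists s.
Qed.

Lemma bounded_on_range (R : realType) (D P : nat) (S : set 'rV[R]_D)
    (cS : compact S) (f : Cspace cS P) (W : normedModType R) (g : 'rV[R]_P -> W) :
  continuous g -> exists2 K, 0 < K & forall s, `|g (f s)| <= K.
Proof.
move=> cg.
have cgf := continuous_compact (continuous_subspaceT cg) (@cfun_range_compact _ _ _ _ _ f).
have [M [_ MB]] := compact_bounded cgf.
exists (`|M| + 1); first by rewrite ltr_wpDl.
move=> s; apply: MB; first by rewrite (le_lt_trans (ler_norm _))// ltrDl.
by exists (f s) => //; exists s.
Qed.

Lemma derive_comp_line (R : realType) (P P' : nat) (H : C1map R P P')
    (y h : 'rV[R]_P) (j : 'I_P') (t : R) :
  is_derive t 1 (fun t : R => H (y + t *: h) 0 j) ((h *m 'J H (y + t *: h)) 0 j).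
Proof.
have dH : differentiable H (y + t *: h) by exact: C1_differentiable.
(* the difference quotient along the line is the directional one of [H] *)
have quot : (fun k : R => k^-1 *: (((fun u : R => H (y + u *: h)) \o shift t)
      (k *: 1) - H (y + t *: h))) =
    (fun k : R => k^-1 *: ((H \o shift (y + t *: h)) (k *: h) - H (y + t *: h))).
  apply/funext => k /=; congr (_ *: (H _ - _)).
  by rewrite /shift/= scalerDl addrCA [k *: 1]mulr1.
have dl : derivable (fun u : R => H (y + u *: h)) t 1.
  by rewrite /derivable quot; exact: diff_derivable.
split; first by have /derivable_mxP := dl; apply.
have <- : 'D_1 (fun u : R => H (y + u *: h)) t = h *m 'J H (y + t *: h).
  by rewrite -(deriveEjacobian h dH) [LHS]/derive quot.
by rewrite (derive_mx dl) mxE.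
Qed.

(** Along the segment from [f s] to [f s + h] the mean value theorem, used
    coordinate by coordinate, writes the remainder as [h] times an increment of
    the Jacobian, and that increment is small uniformly in [s]. *)
Lemma C1_taylor (R : realType) (D P P' : nat) (S : set 'rV[R]_D)
    (cS : compact S) (f : Cspace cS P) (H : C1map R P P') (eps : R) :
  0 < eps ->
  exists2 delta, 0 < delta & forall s h, `|h| < delta ->
    `|H (f s + h) - H (f s) - h *m 'J H (f s)| <= eps * `|h|.
Proof.
(* [P] comes from the matrix product; [P.+1] avoids dividing by 0 if [P = 0] *)
move=> e0; pose e := eps / P.+1%:R.
have e0' : 0 < e by rewrite divr_gt0.
have [delta d0 Hd] :=
  uniform_continuity_near_range (W := 'M[R]_(P, P')) f (@C1_continuous _ _ _ H) e0'.
exists delta => // s h hd.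
apply: mx_norm_le => [|i j]; first by rewrite mulr_ge0// ltW.
rewrite ord1 !mxE.
have cline : {within `[0, 1], continuous (fun t : R => H (f s + t *: h) 0 j)}.
  apply: continuous_subspaceT => t.
  apply: differentiable_continuous; apply/derivable1_diffP.
  by case: (derive_comp_line H (f s) h j t).
have [c] := MVT ltr01 (fun t _ => derive_comp_line H (f s) h j t) cline.
rewrite in_itv/= => /andP[c0 c1]; rewrite scale1r scale0r addr0 subr0 mulr1 => ->.
have -> : (h *m 'J H (f s + c *: h)) 0 j - \sum_j0 h 0 j0 * 'J H (f s) j0 j =
  (h *m ('J H (f s + c *: h) - 'J H (f s))) 0 j.
  by rewrite mulmxBr !mxE.
rewrite (le_trans (mx_entry_le_norm _ _ _))// (le_trans (mx_norm_mulmx_le _ _))//.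
rewrite mulrAC ler_wpM2r//.
apply: (@le_trans _ _ (P%:R * e)).
  rewrite ler_wpM2l//; apply: Hd; rewrite addrC addKr normrZ gtr0_norm//.
  by rewrite (le_lt_trans _ hd)// ler_piMl// ltW.
by rewrite /e mulrCA ler_piMr ?(ltW e0)// ler_pdivrMr// mul1r ler_nat.
Qed.

(** * Lipschitz approximation of bounded continuous functions *)

Lemma continuous_at_norm (R : realType) (V W : normedModType R) (F : V -> W)
    (x : V) :
  (forall e, 0 < e -> exists2 delta, 0 < delta &
     forall y, `|x - y| < delta -> `|F x - F y| <= e) ->
  {for x, continuous F}.
Proof.
move=> Fx; apply/cvgrPdist_le => e /Fx[delta d0 Fd].
by apply/nbhs_normP; exists delta.
Qed.

Lemma lipschitz_normed_continuous (R : realType) (V W : normedModType R)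
    (F : V -> W) (k : R) :
  (forall x y, `|F x - F y| <= k * `|x - y|) -> continuous F.
Proof.
move=> Fk x; apply/cvgrPdist_le => e e0.
have k1 : 0 < `|k| + 1 by rewrite ltr_wpDl.
apply/nbhs_normP; exists (e / (`|k| + 1)) => /=; first by rewrite divr_gt0.
move=> y /= xy; rewrite (le_trans (Fk x y))//.
apply: (@le_trans _ _ ((`|k| + 1) * `|x - y|)).
  by rewrite ler_wpM2r// (le_trans (ler_norm _))// lerDl.
by rewrite mulrC -ler_pdivlMr// ltW.
Qed.

(** The Pasch-Hausdorff envelopes [Fk x = inf_y (F y + k |x - y|)]. An infimum
    of [k]-Lipschitz functions is [k]-Lipschitz. At a fixed [x], once [k] is
    large the penalty outweighs the oscillation of [F] for all [y] away from [x],
    so only points where [F] is close to [F x] compete in the infimum. *)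
Lemma lipschitz_minorants (R : realType) (V : normedModType R) (F : V -> R)
    (B : R) :
  continuous F -> (forall x, `|F x| <= B) ->
  exists Fk : nat -> V -> R,
    [/\ forall k x y, `|Fk k x - Fk k y| <= k%:R * `|x - y|,
        forall k x, `|Fk k x| <= B,
        forall k x, Fk k x <= F x &
        forall x, Fk k x @[k --> \oo] --> F x].
Proof.
move=> cF FB.
pose A k x := [set F y + k%:R * `|x - y| | y in [set: V]].
pose Fk (k : nat) x := inf (A k x).
have FgeB y : - B <= F y by have := FB y; rewrite ler_norml => /andP[].
have lbA k x : lbound (A k x) (- B).
  by move=> _ [y _ <-]; rewrite (le_trans (FgeB y))// lerDl mulr_ge0.
have A0 k x : A k x !=set0 by exists (F x + k%:R * `|x - x|); exists x.
have hA k x : has_inf (A k x) by split => //; exists (- B).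
have Fkle k x y : Fk k x <= F y + k%:R * `|x - y|.
  by apply: ge_inf; [exists (- B) | exists y].
have leFk k x M : (forall y, M <= F y + k%:R * `|x - y|) -> M <= Fk k x.
  by move=> MF; apply: lb_le_inf => // _ [y _ <-].
have FkF k x : Fk k x <= F x.
  by have := Fkle k x x; rewrite subrr normr0 mulr0 addr0.
have Fklip k x y : Fk k x - k%:R * `|x - y| <= Fk k y.
  apply: leFk => z; rewrite lerBlDr (le_trans (Fkle k x z))// -addrA lerD2l.
  by rewrite -mulrDr ler_wpM2l// [leRHS]addrC ler_distD.
exists Fk; split => //.
- move=> k x y; have := Fklip k y x; have := Fklip k x y.
  rewrite (distrC y) ler_norml; set t := _ * _ => xy yx.
  by apply/andP; split; lra.
- move=> k x; rewrite ler_norml; apply/andP; split.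
    exact: lb_le_inf.
  by rewrite (le_trans (FkF k x))// (le_trans (ler_norm _)).
- move=> x; apply/cvgrPdist_le => e e0.
  have /cvgrPdist_le/(_ _ e0)/nbhs_normP[/= r r0 Fr] := cF x.
  near=> k.
  rewrite ger0_norm ?subr_ge0// lerBlDr addrC -lerBlDr; apply: leFk => y.
  have [xy|yx] := ltP `|x - y| r.
    have /= := Fr y xy; rewrite ler_norml => /andP[_]; rewrite lerBlDr => Fxy.
    by rewrite lerBlDr (le_trans Fxy)// addrC lerD2r lerDl mulr_ge0.
  (* away from [x] the penalty alone exceeds the whole oscillation of [F] *)
  have kB : B + B <= k%:R * r.
    rewrite -ler_pdivrMr//; near: k; exact: nbhs_infty_ger.
  apply: (@le_trans _ _ (- B + k%:R * r)); last first.
    by rewrite lerD// ler_wpM2l.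
  have := FB x; rewrite ler_norml => /andP[_ FxB].
  by have := kB; lra.
Unshelve. all: by end_near. Qed.

(** * Integrals of bounded random variables *)

Lemma bounded_integrable (d : measure_display) (T : measurableType d)
    (R : realType) (P : probability T R) (f : T -> R) (B : R) :
  measurable_fun [set: T] f -> (forall w, `|f w| <= B) ->
  P.-integrable [set: T] (EFin \o f).
Proof.
move=> mf fB; apply: measurable_bounded_integrable => //.
  exact: fin_num_fun_lty (@fin_num_measure _ _ _ P).
by exists B; split; [exact: num_real|move=> M BM w _; exact: le_trans (fB w) (ltW BM)].
Qed.

(** Weak convergence speaks of extended real expectations; as real integrals
    they can be subtracted and compared by linear arithmetic. *)
Lemma expectation_Rintegral (d : measure_display) (T : measurableType d)
    (R : realType) (P : probability T R) (f : T -> R) :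
  P.-integrable [set: T] (EFin \o f) -> 'E_P[f]%E = (\int[P]_w f w)%:E.
Proof. by move=> fi; rewrite unlock /Rintegral fineK// integrable_fin_num. Qed.

Lemma Rintegral_le_shift (d : measure_display) (T : measurableType d)
    (R : realType) (P : probability T R) (f g : T -> R) (a : R) :
  P.-integrable [set: T] (EFin \o f) -> P.-integrable [set: T] (EFin \o g) ->
  (forall w, f w <= g w + a) ->
  \int[P]_w f w <= \int[P]_w g w + a.
Proof.
move=> fi gi fg.
have ca : P.-integrable [set: T] (EFin \o cst a) by exact: finite_measure_integrable_cst.
have <- : \int[P]_w (g w + a) = \int[P]_w g w + a.
  rewrite (RintegralD measurableT gi ca) Rintegral_cst//.
  rewrite [X in fine X](_ : _ = 1%E) ?mulr1//; exact: probability_setT.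
by apply: le_Rintegral => //; exact: (integrableD measurableT gi ca).
Qed.

(** The basic estimate of convergence-in-probability arguments: a bound that
    fails by at most [b] on an unlikely event costs only [b] times its
    probability after integration. *)
Lemma Rintegral_le_off_event (d : measure_display) (T : measurableType d)
    (R : realType) (P : probability T R) (f g : T -> R) (A : set T) (a b p : R) :
  P.-integrable [set: T] (EFin \o f) -> P.-integrable [set: T] (EFin \o g) ->
  measurable A -> (P A <= p%:E)%E -> 0 <= b ->
  (forall w, ~ A w -> f w <= g w + a) -> (forall w, A w -> f w <= g w + a + b) ->
  \int[P]_w f w <= \int[P]_w g w + a + b * p.
Proof.
move=> fi gi mA PAp b0 fgC fgA.
have iA : P.-integrable [set: T] (EFin \o (\1_A : T -> R)).
  apply: (bounded_integrable _ (B := 1)) => [|w]; first exact: measurable_indic.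
  by rewrite indicE; case: (w \in A); rewrite ?normr1 ?normr0.
have biA : P.-integrable [set: T] (EFin \o (fun w => b * \1_A w)).
  exact: (integrableZl measurableT b iA).
have : \int[P]_w f w <= \int[P]_w (g w + b * \1_A w) + a.
  apply: Rintegral_le_shift => //; first exact: (integrableD measurableT gi biA).
  move=> w; rewrite indicE; have [/set_mem Aw|nAw] := boolP (w \in A).
    by rewrite mulr1 addrAC; exact: fgA.
  by rewrite mulr0 addr0; apply: fgC => Aw; case/negP: nAw; exact/mem_set.
move=> /le_trans; apply.
rewrite (RintegralD measurableT gi biA) (RintegralZl b measurableT iA).
rewrite addrAC lerD2l ler_wpM2l// /Rintegral integral_indic// setIT.
by rewrite -lee_fin fineK//; exact: fin_num_measure.
Qed.

Lemma Rintegral_dominated_cvg (d : measure_display) (T : measurableType d)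
    (R : realType) (P : probability T R) (fk : nat -> T -> R) (f : T -> R) (B : R) :
  (forall k, measurable_fun [set: T] (fk k)) ->
  (forall k w, `|fk k w| <= B) ->
  (forall w, fk k w @[k --> \oo] --> f w) ->
  \int[P]_w fk k w @[k --> \oo] --> \int[P]_w f w.
Proof.
move=> mf fB ff.
have mlim : measurable_fun [set: T] f.
  by apply: measurable_fun_cvg => // w _; exact: ff.
have fBlim w : `|f w| <= B.
  apply: (closed_cvg (fun y : R => y <= B)) (cvg_norm (ff w)).
    exact: closed_le.
  by near=> k; exact: fB.
have ig : P.-integrable [set: T] (EFin \o cst B) by exact: finite_measure_integrable_cst.
have := @dominated_cvg _ _ _ P _ measurableT (fun k => EFin \o fk k) (EFin \o f) (EFin \o cst B).
move=> /(_ _ _ _ ig _) h.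
apply: fine_cvg; rewrite fineK; last first.
  by rewrite integrable_fin_num//; exact: bounded_integrable fBlim.
apply: h => //.
- by move=> k; exact/measurable_EFinP.
- by move=> w _; apply/cvg_EFin => //; [near=> k|exact: ff].
- by move=> k w _; rewrite lee_fin; exact: fB.
Unshelve. all: by end_near. Qed.

(** * Weak convergence of random continuous functions *)

(** The Borel sigma-algebra of the real line is generated by open intervals, and
    their preimages are open. *)
Lemma continuous_measurable_real (R : realType) (D P : nat) (S : set 'rV[R]_D)
    (cS : compact S) (F : Cspace cS P -> R) :
  continuous F -> measurable_fun [set: Cspace cS P] F.
Proof.
move=> /continuousP cF; apply: (measurability _ (RGenOpens.measurableE R)).
move=> _ [_ [a [b ->] <-]]; rewrite setTI; apply: sub_sigma_algebra.
by apply: cF; exact: interval_open.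
Qed.

Lemma continuous_measurable_Cspace (R : realType) (D P P' : nat)
    (S : set 'rV[R]_D) (cS : compact S) (F : Cspace cS P -> Cspace cS P') :
  continuous F -> measurable_fun [set: Cspace cS P] F.
Proof.
move=> /continuousP cF.
apply: (@measurability _ _ _ _ _ _ (@open (Cspace cS P'))) => //.
move=> _ [U oU <-]; rewrite setTI; apply: sub_sigma_algebra; exact: cF.
Qed.

Lemma measurable_cfun_comp (R : realType) (D P : nat) (S : set 'rV[R]_D)
    (cS : compact S) (d : measure_display) (T : measurableType d)
    (X : T -> Cspace cS P) (F : Cspace cS P -> R) :
  measurable_fun [set: T] X -> continuous F ->
  measurable_fun [set: T] (fun w => F (X w)).
Proof.
by move=> mX cF; exact: (measurableT_comp (continuous_measurable_real cF) mX).
Qed.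

Lemma integrable_cfun_comp (R : realType) (D P : nat) (S : set 'rV[R]_D)
    (cS : compact S) (d : measure_display) (T : measurableType d)
    (Q : probability T R) (X : T -> Cspace cS P) (F : Cspace cS P -> R) (B : R) :
  measurable_fun [set: T] X -> continuous F -> (forall x, `|F x| <= B) ->
  Q.-integrable [set: T] (EFin \o (fun w => F (X w))).
Proof.
move=> mX cF FB; apply: bounded_integrable => [|w]; last exact: FB.
exact: measurable_cfun_comp.
Qed.

Lemma bounded_fun_iff (T : Type) (R : realType) (f : T -> R) :
  bounded_fun f <-> exists B, forall x, `|f x| <= B.
Proof.
split=> [[M [_ fM]]|[B fB]].
  by exists (M + 1) => x; apply: fM => //; rewrite ltrDl.
by exists B; split=> [|M BM x _]; [exact: num_real|exact: le_trans (fB x) (ltW BM)].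
Qed.

Lemma expectation_cvgP (R : realType) (D P : nat) (S : set 'rV[R]_D)
    (cS : compact S)
    (d : nat -> measure_display) (Omega : forall N, measurableType (d N))
    (Pr : forall N, probability (Omega N) R)
    (X : forall N, Omega N -> Cspace cS P)
    (d' : measure_display) (Omega' : measurableType d')
    (Pr' : probability Omega' R) (Y : Omega' -> Cspace cS P)
    (F : Cspace cS P -> R) :
  (forall N, measurable_fun [set: Omega N] (X N)) ->
  measurable_fun [set: Omega'] Y ->
  continuous F -> bounded_fun F ->
  'E_(Pr N)[F \o X N]%E @[N --> \oo] --> 'E_Pr'[F \o Y]%E <->
  \int[Pr N]_w F (X N w) @[N --> \oo] --> \int[Pr']_w F (Y w).
Proof.
move=> mX mY cF /bounded_fun_iff[B FB].
have EX N : 'E_(Pr N)[F \o X N]%E = (\int[Pr N]_w F (X N w))%:E.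
  rewrite expectation_Rintegral//; exact: (integrable_cfun_comp _ (mX N) cF FB).
have EY : 'E_Pr'[F \o Y]%E = (\int[Pr']_w F (Y w))%:E.
  rewrite expectation_Rintegral//; exact: (integrable_cfun_comp _ mY cF FB).
rewrite EY; under eq_fun do rewrite EX.
by split=> [/fine_cvg//|h]; apply/cvg_EFin => //; near=> k.
Unshelve. all: by end_near. Qed.

(** Half of the portmanteau theorem. Bounding [F] from below by a Lipschitz
    minorant gives [E F(Y) <= liminf E F(X_N)]; applying this to [- F] as well
    gives the limit. The approximation error is controlled under the law of [Y]
    only, where dominated convergence applies to a single measure. *)
Lemma weakly_cvg_lipschitz (R : realType) (D P : nat) (S : set 'rV[R]_D)
    (cS : compact S)
    (d : nat -> measure_display) (Omega : forall N, measurableType (d N))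
    (Pr : forall N, probability (Omega N) R)
    (X : forall N, Omega N -> Cspace cS P)
    (d' : measure_display) (Omega' : measurableType d')
    (Pr' : probability Omega' R) (Y : Omega' -> Cspace cS P) :
  (forall N, measurable_fun [set: Omega N] (X N)) ->
  measurable_fun [set: Omega'] Y ->
  (forall (F : Cspace cS P -> R) (k B : R),
     (forall x y, `|F x - F y| <= k * `|x - y|) -> (forall x, `|F x| <= B) ->
     \int[Pr N]_w F (X N w) @[N --> \oo] --> \int[Pr']_w F (Y w)) ->
  weakly_cvg Pr X Pr' Y.
Proof.
move=> mX mY lipcvg.
have lower (F : Cspace cS P -> R) (B : R) : continuous F ->
    (forall x, `|F x| <= B) -> forall e, 0 < e ->
    \forall N \near \oo, \int[Pr']_w F (Y w) <= \int[Pr N]_w F (X N w) + e.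
  move=> cF FB e e0; have [Fk [Flip FkB FkF Fkcvg]] := lipschitz_minorants cF FB.
  have e20 : 0 < e / 2 by rewrite divr_gt0.
  have cFk k : continuous (Fk k) by exact: lipschitz_normed_continuous (Flip k).
  have /cvgrPdist_le/(_ _ e20) : \int[Pr']_w Fk k (Y w) @[k --> \oo] -->
      \int[Pr']_w F (Y w).
    apply: (@Rintegral_dominated_cvg _ _ _ _ (fun k w => Fk k (Y w)) _ B).
    - by move=> k; exact: measurable_cfun_comp mY (cFk k).
    - by move=> k w; exact: FkB.
    - by move=> w; exact: Fkcvg.
  move=> /filter_ex[k]; rewrite ler_norml => /andP[_ Yk].
  have /cvgrPdist_le/(_ _ e20) := lipcvg _ _ _ (Flip k) (FkB k).
  apply: filterS => N; rewrite ler_norml => /andP[_ XN].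
  have : \int[Pr N]_w Fk k (X N w) <= \int[Pr N]_w F (X N w) + 0.
    apply: Rintegral_le_shift => [||w]; last by rewrite addr0.
      exact: (integrable_cfun_comp _ (mX N) (cFk k) (FkB k)).
    exact: (integrable_cfun_comp _ (mX N) cF FB).
  by lra.
split=> // F cF bF; apply/(expectation_cvgP Pr Pr' mX mY cF bF).
have [B FB] := (bounded_fun_iff F).1 bF.
apply/cvgrPdist_le => e e0.
have lo := lower F B cF FB e e0.
have up : \forall N \near \oo, \int[Pr N]_w F (X N w) <= \int[Pr']_w F (Y w) + e.
  have cNF : continuous (fun x => - F x) by move=> x; apply: (@continuousN _ _ _ F x (cF x)).
  have NFB x : `|- F x| <= B by rewrite normrN.
  have opp (d0 : measure_display) (T : measurableType d0) (Q : probability T R)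
      (Z : T -> Cspace cS P) : measurable_fun [set: T] Z ->
      \int[Q]_w - F (Z w) = - \int[Q]_w F (Z w).
    move=> mZ; rewrite -mulN1r -RintegralZl//; last first.
      exact: (integrable_cfun_comp _ mZ cF FB).
    by apply: eq_Rintegral => w _; rewrite mulN1r.
  apply: filterS (lower _ B cNF NFB e e0) => N.
  by rewrite !opp//; lra.
near=> N.
have loN : \int[Pr']_w F (Y w) <= \int[Pr N]_w F (X N w) + e by near: N.
have upN : \int[Pr N]_w F (X N w) <= \int[Pr']_w F (Y w) + e by near: N.
by rewrite ler_norml; apply/andP; split; lra.
Unshelve. all: by end_near. Qed.

Lemma norm_ratio_continuous (R : realType) (V : normedModType R) (a b : R) :
  0 < a -> continuous (fun x : V => b * (`|x| / (a + `|x|))).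
Proof.
move=> a0 x; have cn : continuous (fun x : V => `|x|) by exact: norm_continuous.
apply: cvgM; first exact: cvg_cst.
apply: cvgM; first exact: cn.
apply: cvgV; first by rewrite gt_eqF// ltr_wpDr.
by apply: cvgD; [exact: cvg_cst|exact: cn].
Qed.

(** The continuous functions [2 |x| / (k + 1 + |x|)] dominate the indicator of
    [|x| > k + 1] and tend to 0 as [k] grows. So one [k] makes the expectation
    under the limit small, and weak convergence transfers this to all large
    [N]. *)
Lemma weakly_cvg_tight (R : realType) (D P : nat) (S : set 'rV[R]_D)
    (cS : compact S)
    (d : nat -> measure_display) (Omega : forall N, measurableType (d N))
    (Pr : forall N, probability (Omega N) R)
    (X : forall N, Omega N -> Cspace cS P)
    (d' : measure_display) (Omega' : measurableType d')
    (Pr' : probability Omega' R) (Y : Omega' -> Cspace cS P) (e : R) :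
  weakly_cvg Pr X Pr' Y -> 0 < e ->
  exists2 M : R, 0 < M & \forall N \near \oo,
    measurable [set w | M < `|X N w|] /\
    (Pr N [set w | (M < `|X N w|)%R] < e%:E)%E.
Proof.
move=> [mX mY XY] e0.
pose h (k : nat) (x : Cspace cS P) : R := 2 * (`|x| / (k.+1%:R + `|x|)).
have den k (x : Cspace cS P) : 0 < k.+1%:R + `|x| by rewrite ltr_wpDr.
have ch k : continuous (h k) by exact: norm_ratio_continuous.
have h0 k x : 0 <= h k x by rewrite mulr_ge0// divr_ge0// ltW.
have hB k x : `|h k x| <= 2.
  by rewrite ger0_norm// ler_piMr// ler_pdivrMr// mul1r lerDr.
have h1 k x : k.+1%:R < `|x| -> 1 <= h k x.
  by move=> kx; rewrite /h mulrA ler_pdivlMr//; lra.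
have hcvg x : h k x @[k --> \oo] --> (0 : R).
  apply/cvgr0Pnorm_le => r r0.
  near=> k; rewrite ger0_norm//.
  have kr : 2 * `|x| <= k%:R * r.
    by rewrite -ler_pdivrMr//; near: k; exact: nbhs_infty_ger.
  rewrite /h mulrA ler_pdivrMr// (le_trans kr)// mulrC ler_wpM2l// ?(ltW r0)//.
  by rewrite (@le_trans _ _ k.+1%:R)// ?ler_nat// lerDl.
have : \int[Pr']_w h k (Y w) @[k --> \oo] --> \int[Pr']_w (0 : R).
  apply: (@Rintegral_dominated_cvg _ _ _ _ (fun k w => h k (Y w)) _ 2).
  - by move=> k; exact: measurable_cfun_comp mY (ch k).
  - by move=> k w; exact: hB.
  - by move=> w; exact: hcvg.
rewrite Rintegral_cst// mul0r => /cvgr0Pnorm_lt/(_ _ e0)/filter_ex[k Yk].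
exists k.+1%:R => //.
have bh : bounded_fun (h k) by apply/bounded_fun_iff; exists 2.
have /cvgr_norm_lt/(_ _ Yk) := (expectation_cvgP Pr Pr' mX mY (ch k) bh).1 (XY _ (ch k) bh).
apply: filterS => N XN.
have mA : measurable [set w | k.+1%:R < `|X N w|].
  have : measurable_fun [set: Omega N] (fun w => `|X N w|).
    exact: measurable_cfun_comp (mX N) (@norm_continuous _ _).
  move=> /(_ measurableT _ (measurable_itv `]k.+1%:R, +oo[)).
  by rewrite setTI preimage_itvoy.
split=> //; rewrite -(expectation_indic (Pr N) mA).
apply: (@le_lt_trans _ _ 'E_(Pr N)[h k \o X N]%E).
  apply: expectation_le => //.
  - exact: measurable_cfun_comp (mX N) (ch k).
  - by move=> w; exact: h0.
  - apply: aeW => w /=; rewrite indicE.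
    by case: (boolP (w \in _)) => [/set_mem/= /h1|_]; last exact: h0.
rewrite expectation_Rintegral ?lte_fin; first exact: le_lt_trans (ler_norm _) XN.
exact: (integrable_cfun_comp _ (mX N) (ch k) (hB k)).
Unshelve. all: by end_near. Qed.

(** Slutsky's lemma: sequences that are uniformly close outside events of
    small probability have the same weak limit. Testing against Lipschitz
    functions converts closeness of the arguments into closeness of the
    values. *)
Lemma weakly_cvg_close (R : realType) (D P : nat) (S : set 'rV[R]_D)
    (cS : compact S)
    (d : nat -> measure_display) (Omega : forall N, measurableType (d N))
    (Pr : forall N, probability (Omega N) R)
    (X Z : forall N, Omega N -> Cspace cS P)
    (d' : measure_display) (Omega' : measurableType d')
    (Pr' : probability Omega' R) (Y : Omega' -> Cspace cS P) :
  weakly_cvg Pr X Pr' Y -> (forall N, measurable_fun [set: Omega N] (Z N)) ->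
  (forall e p : R, 0 < e -> 0 < p -> \forall N \near \oo,
     exists A : set (Omega N), [/\ measurable A, (Pr N A <= p%:E)%E &
       forall w, ~ A w -> `|Z N w - X N w| <= e]) ->
  weakly_cvg Pr Z Pr' Y.
Proof.
move=> [mX mY XY] mZ close; apply: weakly_cvg_lipschitz => // F k B Flip FB.
have cF : continuous F := lipschitz_normed_continuous Flip.
have bF : bounded_fun F by apply/bounded_fun_iff; exists B.
apply/cvgrPdist_le => e e0.
have B0 : 0 <= B by exact: le_trans (FB 0).
have k1 : 0 < `|k| + 1 by rewrite ltr_wpDl.
have B1 : 0 < B + B + 1 by rewrite ltr_wpDl// addr_ge0.
(* a third of [e] each for weak convergence, the Lipschitz error off the
   event, and the oscillation of [F], at most [B + B], on the event; adding 1
   keeps the denominators positive *)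
have e1 : 0 < e / 3 / (`|k| + 1) by rewrite !divr_gt0.
have p1 : 0 < e / 3 / (B + B + 1) by rewrite !divr_gt0.
have e3 : 0 < e / 3 by rewrite divr_gt0.
have /cvgrPdist_le/(_ _ e3) := (expectation_cvgP Pr Pr' mX mY cF bF).1 (XY _ cF bF).
apply: filterS2 (close _ _ e1 p1) => N [A [mA PA ZX]].
have FZX w : ~ A w -> `|F (Z N w) - F (X N w)| <= e / 3.
  move=> nAw; rewrite (le_trans (Flip _ _))//.
  apply: (@le_trans _ _ ((`|k| + 1) * `|Z N w - X N w|)).
    by rewrite ler_wpM2r// (le_trans (ler_norm _))// lerDl.
  by rewrite mulrC -ler_pdivlMr//; exact: ZX.
have FBB x y : F x <= F y + e / 3 + (B + B).
  have := FB x; have := FB y; rewrite !ler_norml => /andP[? ?] /andP[? ?]; lra.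
have iZ := integrable_cfun_comp (Pr N) (mZ N) cF FB.
have iX := integrable_cfun_comp (Pr N) (mX N) cF FB.
have Bp : (B + B) * (e / 3 / (B + B + 1)) <= e / 3.
  by rewrite mulrCA ler_piMr ?(ltW e3)// ler_pdivrMr// mul1r lerDl.
have B20 : 0 <= B + B by exact: addr_ge0.
have FZ w : ~ A w -> F (Z N w) <= F (X N w) + e / 3.
  by move=> /FZX; rewrite ler_norml => /andP[? ?]; lra.
have FX w : ~ A w -> F (X N w) <= F (Z N w) + e / 3.
  by move=> /FZX; rewrite ler_norml => /andP[? ?]; lra.
have ZleX := Rintegral_le_off_event iZ iX mA PA B20 FZ
  (fun w _ => FBB (Z N w) (X N w)).
have XleZ := Rintegral_le_off_event iX iZ mA PA B20 FX
  (fun w _ => FBB (X N w) (Z N w)).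
rewrite ler_norml => /andP[YX1 YX2].
by rewrite ler_norml; apply/andP; split; lra.
Qed.

Lemma weakly_cvg_continuous_map (R : realType) (D P P' : nat) (S : set 'rV[R]_D)
    (cS : compact S)
    (d : nat -> measure_display) (Omega : forall N, measurableType (d N))
    (Pr : forall N, probability (Omega N) R)
    (X : forall N, Omega N -> Cspace cS P)
    (d' : measure_display) (Omega' : measurableType d')
    (Pr' : probability Omega' R) (Y : Omega' -> Cspace cS P)
    (Phi : Cspace cS P -> Cspace cS P') :
  continuous Phi -> weakly_cvg Pr X Pr' Y ->
  weakly_cvg Pr (fun N w => Phi (X N w)) Pr' (fun w => Phi (Y w)).
Proof.
move=> cPhi [mX mY XY]; have mPhi := continuous_measurable_Cspace cPhi.
split=> [N||F cF /bounded_fun_iff[B FB]]; [exact: measurableT_comp mPhi (mX N)|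
  exact: measurableT_comp mPhi mY|].
apply: (XY (F \o Phi)).
  by move=> x; apply: continuous_comp; [exact: cPhi|exact: cF].
by apply/bounded_fun_iff; exists B => x; exact: FB.
Qed.

(** * Composition and derivative as operators between spaces of continuous functions *)

Lemma cfunBE (R : realType) (D P : nat) (S : set 'rV[R]_D)
    (cS : compact S) (f g : Cspace cS P) (s : S) : (f - g) s = f s - g s.
Proof. by []. Qed.

Lemma cfunZE (R : realType) (D P : nat) (S : set 'rV[R]_D)
    (cS : compact S) (a : R) (f : Cspace cS P) (s : S) : (a *: f) s = a *: f s.
Proof. by []. Qed.

Lemma cfun_sumE (R : realType) (D P : nat) (S : set 'rV[R]_D) (cS : compact S)
    (N : nat) (r : 'I_N -> Cspace cS P) (s : S) :
  (\sum_(n < N) r n) s = \sum_(n < N) r n s.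
Proof.
exact: (big_morph (fun f : Cspace cS P => f s) (fun f g => erefl) erefl).
Qed.

Lemma cfun_le_norm (R : realType) (D P : nat) (S : set 'rV[R]_D)
    (cS : compact S) (f : Cspace cS P) (s : S) : `|f s| <= `|f|.
Proof. exact: cfun_norm_ub. Qed.

Lemma cfun_coord_continuous (R : realType) (D P : nat) (S : set 'rV[R]_D)
    (cS : compact S) (s : S) (i : 'I_P) :
  continuous (fun x : Cspace cS P => x s 0 i).
Proof.
apply: (@lipschitz_normed_continuous _ _ R^o _ 1) => x y; rewrite mul1r.
have := mx_entry_le_norm ((x - y) s) 0 i; rewrite cfunBE !mxE => /le_trans; apply.
exact: (cfun_le_norm (x - y) s).
Qed.

Lemma cfun_diffE (R : realType) (D P P' : nat) (S : set 'rV[R]_D)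
    (cS : compact S) (H : C1map R P P') (f g : Cspace cS P) (s : S) :
  cfun_diff H f g s = g s *m 'J H (f s).
Proof. exact: diffEjacobian. Qed.

(** The operator [dH_f] is bounded because the Jacobian is bounded on the
    compact range of [f]. *)
Lemma cfun_diff_lipschitz (R : realType) (D P P' : nat) (S : set 'rV[R]_D)
    (cS : compact S) (H : C1map R P P') (f : Cspace cS P) :
  exists K : R, forall x y : Cspace cS P,
    `|cfun_diff H f x - cfun_diff H f y| <= K * `|x - y|.
Proof.
have [K K0 JK] := bounded_on_range f (W := 'M[R]_(P, P')) (@C1_continuous _ _ _ H).
exists (P%:R * K) => x y; apply: cfun_norm_le => [|s].
  by rewrite !mulr_ge0// ltW.
rewrite cfunBE !cfun_diffE -mulmxBl (le_trans (mx_norm_mulmx_le _ _))//.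
rewrite mulrAC ler_pM// ?mulr_ge0// ?ler_wpM2l//.
exact: (cfun_le_norm (x - y) s).
Qed.

Lemma cfun_diff_operator_continuous (R : realType) (D P P' : nat)
    (S : set 'rV[R]_D) (cS : compact S) (H : C1map R P P') (f : Cspace cS P) :
  continuous (cfun_diff H f).
Proof.
by have [K HK] := cfun_diff_lipschitz H f; exact: lipschitz_normed_continuous HK.
Qed.

Lemma cfun_comp_operator_continuous (R : realType) (D P P' : nat)
    (S : set 'rV[R]_D) (cS : compact S) (H : C1map R P P') :
  continuous (cfun_comp H : Cspace cS P -> Cspace cS P').
Proof.
move=> f; apply: continuous_at_norm => e e0.
have cH : continuous H.
  by move=> x; exact/differentiable_continuous/C1_differentiable.
have [delta d0 Hd] := uniform_continuity_near_range f cH e0.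
exists delta => // g fg.
apply: cfun_norm_le => [|s]; first exact: ltW.
rewrite cfunBE/= distrC; apply: Hd.
rewrite (le_lt_trans _ fg)// distrC; exact: (cfun_le_norm (f - g) s).
Qed.

(** * The functional delta method *)

(** On [|sqrt N (x - theta)| <= M] the increment [x - theta] is at most
    [M / sqrt N], hence in the range of validity of the Taylor estimate, whose
    relative error [e / M] is scaled back by [sqrt N] to at most [e]. *)
Lemma delta_remainder (R : realType) (D P P' : nat) (S : set 'rV[R]_D)
    (cS : compact S) (H : C1map R P P') (theta : Cspace cS P) (M e : R) :
  0 < M -> 0 < e -> \forall N \near \oo, forall x : Cspace cS P,
    `|Num.sqrt (N%:R : R) *: (x - theta)| <= M ->
    `|Num.sqrt (N%:R : R) *: (cfun_comp H x - cfun_comp H theta) -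
      cfun_diff H theta (Num.sqrt (N%:R : R) *: (x - theta))| <= e.
Proof.
move=> M0 e0; have e1 : 0 < e / M by rewrite divr_gt0.
have [delta d0 Hd] := C1_taylor theta H e1.
near=> N => x xM.
have sN0 : 0 < Num.sqrt (N%:R : R).
  by rewrite sqrtr_gt0 ltr0n; near: N; exact: nbhs_infty_gt.
have MN : M < Num.sqrt N%:R * delta.
  have Md0 : 0 <= M / delta by rewrite divr_ge0// ltW.
  rewrite -ltr_pdivrMr// -[ltLHS]ger0_norm// -sqrtr_sqr ltr_sqrt.
    by near: N; exact: nbhs_infty_gtr.
  by rewrite ltr0n; near: N; exact: nbhs_infty_gt.
have xd : `|x - theta| < delta.
  rewrite -(ltr_pM2l sN0) (le_lt_trans _ MN)// (le_trans _ xM)//.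
  by rewrite normrZ gtr0_norm.
apply: cfun_norm_le => [|s]; first exact: ltW.
rewrite cfunBE cfun_diffE !cfunZE !cfunBE -scalemxAl -scalerBr normrZ gtr0_norm//.
have hs : `|x s - theta s| <= `|x - theta| by exact: (cfun_le_norm (x - theta) s).
have := Hd s (x s - theta s) (le_lt_trans hs xd); rewrite [theta s + _]addrC subrK => Hs.
rewrite (le_trans (ler_wpM2l (ltW sN0) Hs))//.
rewrite mulrCA -[leRHS](divfK (lt0r_neq0 M0)) ler_wpM2l ?(ltW e1)//.
rewrite (le_trans _ xM)// normrZ gtr0_norm// ler_wpM2l//; exact: ltW.
Unshelve. all: by end_near. Qed.

Lemma continuous_affine_comp (R : realType) (V W : normedModType R) (F : V -> W)
    (a : R) (v : W) :
  continuous F -> continuous (fun x => a *: (F x - v)).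
Proof.
move=> cF x; apply: cvgZl_tmp; apply: cvgB; first exact: cF.
exact: cvg_cst.
Qed.

(** The event to discard is [|X_N| > M]: tightness makes it unlikely, and on its
    complement the remainder estimate is deterministic. *)
Lemma delta_method (R : realType) (D P P' : nat) (S : set 'rV[R]_D)
    (cS : compact S)
    (d : nat -> measure_display) (Omega : forall N, measurableType (d N))
    (Pr : forall N, probability (Omega N) R)
    (thetahat : forall N, Omega N -> Cspace cS P) (theta : Cspace cS P)
    (d' : measure_display) (Omega' : measurableType d')
    (Pr' : probability Omega' R) (G : Omega' -> Cspace cS P)
    (H : C1map R P P') :
  (forall N, measurable_fun [set: Omega N] (thetahat N)) ->
  weakly_cvg Pr
    (fun N w => Num.sqrt (N%:R : R) *: (thetahat N w - theta)) Pr' G ->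
  weakly_cvg Pr
    (fun N w => Num.sqrt (N%:R : R) *:
      (cfun_comp H (thetahat N w) - cfun_comp H theta)) Pr'
    (fun w => cfun_diff H theta (G w)).
Proof.
move=> mth hcvg.
have cdiff := @cfun_diff_operator_continuous _ _ _ _ _ cS H theta.
apply: weakly_cvg_close (weakly_cvg_continuous_map cdiff hcvg) _ _ => [N|e p e0 p0].
  have cPhi : continuous (fun x : Cspace cS P =>
      Num.sqrt (N%:R : R) *: (cfun_comp H x - cfun_comp H theta)).
    apply: continuous_affine_comp; exact: cfun_comp_operator_continuous.
  exact: (measurableT_comp (continuous_measurable_Cspace cPhi) (mth N)).
have [M M0] := weakly_cvg_tight hcvg p0.
apply: filterS2 (delta_remainder H theta M0 e0) => N rem [mA PA].
exists [set w | M < `|Num.sqrt (N%:R : R) *: (thetahat N w - theta)|].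
split=> //; first exact: ltW.
by move=> w /negP; rewrite -leNgt => /rem.
Qed.

(** Dividing a tight sequence by [sqrt N] sends it to 0 in probability. *)
Lemma estimator_consistent (R : realType) (D P : nat) (S : set 'rV[R]_D)
    (cS : compact S)
    (d : nat -> measure_display) (Omega : forall N, measurableType (d N))
    (Pr : forall N, probability (Omega N) R)
    (thetahat : forall N, Omega N -> Cspace cS P) (theta : Cspace cS P)
    (d' : measure_display) (Omega' : measurableType d')
    (Pr' : probability Omega' R) (G : Omega' -> Cspace cS P) (delta e : R) :
  weakly_cvg Pr
    (fun N w => Num.sqrt (N%:R : R) *: (thetahat N w - theta)) Pr' G ->
  0 < delta -> 0 < e ->
  \forall N \near \oo, ((Pr N)^*%mu
    [set w | (delta <= `|thetahat N w - theta|)%R] < e%:E)%E.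
Proof.
move=> hcvg d0 e0.
have [M M0] := weakly_cvg_tight hcvg e0.
apply: filter_app; near=> N => -[mA]; rewrite -(measurable_mu_extE _ mA).
apply: le_lt_trans; apply: le_mu_ext => w /= dw.
have sN0 : 0 < Num.sqrt (N%:R : R).
  by rewrite sqrtr_gt0 ltr0n; near: N; exact: nbhs_infty_gt.
have Md0 : 0 <= M / delta by rewrite divr_ge0// ltW.
rewrite normrZ gtr0_norm// -ltr_pdivrMr; last exact: lt_le_trans dw.
apply: (@le_lt_trans _ _ (M / delta)).
  by rewrite ler_wpM2l ?(ltW M0)// lef_pV2// posrE//; exact: lt_le_trans dw.
rewrite -[ltLHS]ger0_norm// -sqrtr_sqr ltr_sqrt.
  by near: N; exact: nbhs_infty_gtr.
by rewrite ltr0n; near: N; exact: nbhs_infty_gt.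
Unshelve. all: by end_near. Qed.

(** * The Gaussian limit *)

(** The diagonal of the covariance is the integral of a nonnegative function,
    so its being a real number already says that the square is integrable. *)
Lemma has_covariance_L2 (R : realType) (D P : nat) (S : set 'rV[R]_D)
    (cS : compact S) (d : measure_display) (Omega : measurableType d)
    (Pr : probability Omega R) (X : Omega -> Cspace cS P)
    (c : S -> S -> 'M[R]_P) (s : S) (i : 'I_P) :
  measurable_fun [set: Omega] (fun w => X w s 0 i) ->
  has_covariance Pr X c ->
  Pr.-integrable [set: Omega] (EFin \o (fun w => X w s 0 i ^+ 2)).
Proof.
move=> mX /(_ s s i i) cX.
have m2 : measurable_fun [set: Omega] (fun w => X w s 0 i ^+ 2).
  exact: measurable_funX.
apply/integrableP; split; first exact/measurable_EFinP.
have <- : 'E_Pr[(fun w => ((X w s)^T *m X w s) i i)%R]%E =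
  (\int[Pr]_w `|(EFin \o (fun w => X w s 0 i ^+ 2)%R) w|)%E.
  rewrite unlock; apply: eq_integral => w _ /=.
  by rewrite mxE big_ord1 mxE ger0_norm ?sqr_ge0// expr2.
by rewrite cX ltry.
Qed.

(** From [|f g| <= f^2 + g^2]. *)
Lemma L2_integrable_mul (d : measure_display) (T : measurableType d)
    (R : realType) (P : probability T R) (f g : T -> R) :
  measurable_fun [set: T] f -> measurable_fun [set: T] g ->
  P.-integrable [set: T] (EFin \o (fun w => f w ^+ 2)) ->
  P.-integrable [set: T] (EFin \o (fun w => g w ^+ 2)) ->
  P.-integrable [set: T] (EFin \o (fun w => f w * g w)).
Proof.
move=> mf mg f2 g2.
apply: (le_integrable measurableT _ _ (integrableD measurableT f2 g2)).
  by apply/measurable_EFinP; exact: measurable_funM.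
move=> w _ /=; rewrite lee_fin [leRHS]ger0_norm ?addr_ge0 ?sqr_ge0//.
rewrite ler_norml; apply/andP; split; nra.
Qed.

Lemma integrable_lincomb (d : measure_display) (T : measurableType d)
    (R : realType) (P : probability T R) (n : nat) (a : 'I_n -> R)
    (f : 'I_n -> T -> R) :
  (forall k, P.-integrable [set: T] (EFin \o f k)) ->
  P.-integrable [set: T] (EFin \o (fun w => \sum_(k < n) a k * f k w)).
Proof.
move=> fi; under [EFin \o _]eq_fun do rewrite /= -sumEFin.
by apply: integrable_sum => // k _; exact: (integrableZl measurableT (a k) (fi k)).
Qed.

Lemma expectation_lincomb (d : measure_display) (T : measurableType d)
    (R : realType) (P : probability T R) (n : nat) (a : 'I_n -> R)
    (f : 'I_n -> T -> R) (m : 'I_n -> R) :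
  (forall k, P.-integrable [set: T] (EFin \o f k)) ->
  (forall k, 'E_P[f k]%E = (m k)%:E) ->
  'E_P[(fun w => \sum_(k < n) a k * f k w)%R]%E = (\sum_(k < n) a k * m k)%:E.
Proof.
move=> fi fm; rewrite unlock.
under eq_integral do rewrite -sumEFin.
rewrite integral_sum//; last by move=> k; exact: (integrableZl measurableT (a k) (fi k)).
rewrite -sumEFin; apply: eq_bigr => k _.
rewrite EFinM -fm unlock -(integralZl measurableT (fi k)).
by apply: eq_integral => w _; rewrite EFinM.
Qed.

Lemma cfun_diff_coord (R : realType) (D P P' : nat) (S : set 'rV[R]_D)
    (cS : compact S) (H : C1map R P P') (f g : Cspace cS P) (s : S) (i : 'I_P') :
  cfun_diff H f g s 0 i = \sum_j 'J H (f s) j i * g s 0 j.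
Proof. by rewrite cfun_diffE mxE; apply: eq_bigr => j _; rewrite mulrC. Qed.

(** Pairing with the image of [g] is pairing [g] with the adjoint; this reduces
    linear functionals of the transformed process to those of the original
    one. *)
Lemma cfun_diff_adjoint (R : realType) (D P P' : nat) (S : set 'rV[R]_D)
    (cS : compact S) (H : C1map R P P') (f g : Cspace cS P) (s : S)
    (a : 'rV[R]_P') :
  \sum_i a 0 i * cfun_diff H f g s 0 i =
  \sum_j (a *m ('J H (f s))^T) 0 j * g s 0 j.
Proof.
under eq_bigr do rewrite cfun_diffE; move: ('J H (f s)) => A.
rewrite [RHS](eq_bigr (fun j => \sum_i a 0 i * A^T i j * g s 0 j)); last first.
  by move=> j _; rewrite mxE big_distrl.
rewrite exchange_big/=; apply: eq_bigr => i _.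
rewrite mxE big_distrr/=; apply: eq_bigr => j _.
by rewrite mxE mulrA mulrAC.
Qed.

Lemma tr_mulmx_entry (R : realType) (P P' : nat) (A B : 'M[R]_(P, P'))
    (C : 'M[R]_P) (i j : 'I_P') :
  (A^T *m C *m B) i j = \sum_l B l j * (\sum_k A k i * C k l).
Proof.
rewrite mxE; apply: eq_bigr => l _; rewrite mulrC mxE; congr (_ * _).
by apply: eq_bigr => k _; rewrite mxE.
Qed.

Lemma cfun_diff_outer (R : realType) (D P P' : nat) (S : set 'rV[R]_D)
    (cS : compact S) (H : C1map R P P') (f g h : Cspace cS P) (s s' : S)
    (i j : 'I_P') :
  ((cfun_diff H f g s)^T *m cfun_diff H f h s') i j =
  \sum_l 'J H (f s') l j *
    (\sum_k 'J H (f s) k i * ((g s)^T *m h s') k l).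
Proof.
by rewrite !cfun_diffE trmx_mul mulmxA -(mulmxA _ _ (h s')) tr_mulmx_entry.
Qed.

(** A Gaussian process stays Gaussian under [dH_theta], since each linear
    functional of the image is a linear functional of the original. First moments
    are finite because second moments are: [G] is the product of [G] and the
    constant 1. *)
Lemma gaussian_cfun_diff (R : realType) (D P P' : nat)
    (S : set 'rV[R]_D) (cS : compact S) (d : measure_display)
    (Omega : measurableType d) (Pr : probability Omega R)
    (G : Omega -> Cspace cS P) (c : S -> S -> 'M[R]_P)
    (theta : Cspace cS P) (H : C1map R P P') :
  zero_mean_gaussian_process Pr G c ->
  zero_mean_gaussian_process Pr (fun w => cfun_diff H theta (G w))
    (fun s s' => dmx H (theta s) *m c s s' *m (dmx H (theta s'))^T).
Proof.
move=> [[mG gG] zG cG].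
have mGsi s i : measurable_fun [set: Omega] (fun w => G w s 0 i).
  exact: measurable_cfun_comp mG (@cfun_coord_continuous _ _ _ _ _ s i).
have G2 s i := has_covariance_L2 (mGsi s i) cG.
have GG s s' i j := L2_integrable_mul (mGsi s i) (mGsi s' j) (G2 s i) (G2 s' j).
have G1 s i : Pr.-integrable [set: Omega] (EFin \o (fun w => G w s 0 i)).
  have one2 : Pr.-integrable [set: Omega] (EFin \o (fun w => cst (1 : R) w ^+ 2)).
    under eq_fun do rewrite expr1n.
    exact: finite_measure_integrable_cst.
  have := L2_integrable_mul (mGsi s i) (measurable_cst (1 : R)) (G2 s i) one2.
  by under eq_fun do rewrite mulr1.
split; first split.
- exact: measurableT_comp
    (continuous_measurable_Cspace (@cfun_diff_operator_continuous _ _ _ _ _ cS H theta)) mG.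
- move=> n s a.
  have := gG n s (fun k => a k *m ('J H (theta (s k)))^T).
  congr gaussian_rv; apply/funext => w; apply: eq_bigr => k _.
  by rewrite -cfun_diff_adjoint.
- move=> s i.
  rewrite [X in expectation _ X](_ : _ =
      (fun w => \sum_j 'J H (theta s) j i * G w s 0 j)); last first.
    by apply/funext => w; exact: cfun_diff_coord.
  rewrite (@expectation_lincomb _ _ _ _ _ _ _ (fun=> 0)).
  - by rewrite big1// => j _; rewrite mulr0.
  - by move=> j; exact: G1.
  - by move=> j; exact: zG.
- move=> s s' i j.
  rewrite [X in expectation _ X](_ : _ = (fun w => \sum_l 'J H (theta s') l j *
      (\sum_k 'J H (theta s) k i * ((G w s)^T *m G w s') k l))); last first.
    by apply/funext => w; exact: cfun_diff_outer.
  have iM k l : Pr.-integrable [set: Omega]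
      (EFin \o (fun w => ((G w s)^T *m G w s') k l)).
    have := GG s s' k l; congr (_.-integrable _ _); apply/funext => w /=.
    by rewrite mxE big_ord1 mxE.
  rewrite (@expectation_lincomb _ _ _ _ _ _ _ (fun l => \sum_k 'J H (theta s) k i * c s s' k l)).
  - by rewrite /dmx trmxK tr_mulmx_entry.
  - by move=> l; apply: integrable_lincomb => k; exact: iM.
  - by move=> l; rewrite (@expectation_lincomb _ _ _ _ _ _ _ (fun k => c s s' k l)).
Qed.

(** * Residuals transported by the derivative *)

Lemma cvge0_leP (R : realType) (u : nat -> \bar R) :
  (forall N, 0 <= u N)%E ->
  u N @[N --> \oo] --> 0%E <->
  (forall e : R, 0 < e -> \forall N \near \oo, (u N <= e%:E)%E).
Proof.
move=> u0; split=> [/fine_cvgP[ufin /cvgr0Pnorm_le ucvg] e e0|ule].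
  apply: filterS2 ufin (ucvg e e0) => N uN; rewrite ger0_norm ?fine_ge0// => ?.
  by rewrite -(fineK uN) lee_fin.
have ufin N (e : R) : (u N <= e%:E)%E -> u N \is a fin_num.
  by move=> uNe; rewrite ge0_fin_numE// (le_lt_trans uNe)// ltry.
apply/fine_cvgP; split; first by apply: filterS (ule 1 ltr01) => N; exact: ufin.
apply/cvgr0Pnorm_le => e e0; apply: filterS (ule e e0) => N uNe.
by rewrite /= ger0_norm ?fine_ge0// -lee_fin fineK//; exact: ufin uNe.
Qed.

Lemma mu_ext_probability_ge0 (d : measure_display) (T : measurableType d)
    (R : realType) (P : probability T R) (A : set T) : (0 <= P^*%mu A)%E.
Proof. by apply: mu_ext_ge0 => X; exact: measure_ge0. Qed.

(** Uniform convergence in probability makes the exceptional event have outer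
    measure below 1 for some [N], so it is not the whole space and some outcome
    avoids it. *)
Lemma cvg_unif_in_prob_witness (R : realType) (D P : nat) (S : set 'rV[R]_D)
    (d : nat -> measure_display) (Omega : forall N, measurableType (d N))
    (Pr : forall N, probability (Omega N) R)
    (A : forall N, Omega N -> S -> S -> 'M[R]_P) (c : S -> S -> 'M[R]_P) :
  cvg_unif_in_prob Pr A c ->
  exists N (w : Omega N), forall s s', `|A N w s s' - c s s'| <= 1.
Proof.
move=> /(_ 1 ltr01)/cvge0_leP.
have half0 : 0 < 1 / 2 :> R by rewrite divr_gt0.
move=> /(_ (fun N => mu_ext_probability_ge0 _ _) _ half0)/filter_ex[N Nhalf].
exists N; apply: contrapT => nogood.
have badT : [set w | exists s s' : S, 1 < `|A N w s s' - c s s'|] = setT.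
  apply/seteqP; split=> // w _ /=; apply: contrapT => nbad.
  apply: nogood; exists w => s s'; rewrite leNgt; apply/negP => bad.
  by apply: nbad; exists s, s'.
have PT : (Pr N)^*%mu setT = 1%E.
  by rewrite measurable_mu_extE//; exact: probability_setT.
by move: Nhalf; rewrite badT PT lee_fin; lra.
Qed.

Lemma sample_cov_bounded (R : realType) (D P : nat) (S : set 'rV[R]_D)
    (cS : compact S) (N : nat) (r : 'I_N -> Cspace cS P) :
  exists K, forall s s', `|sample_cov r s s'| <= K.
Proof.
exists (`|N%:R^-1| * \sum_(n < N) (`|r n| * `|r n|)) => s s'.
rewrite /sample_cov normrZ ler_wpM2l// (le_trans (ler_norm_sum _ _ _))//.
apply: ler_sum => n _; rewrite (le_trans (mx_norm_mulmx_le _ _))// mul1r mx_norm_tr.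
by rewrite ler_pM//; exact: cfun_le_norm.
Qed.

Lemma sample_cov_diff (R : realType) (D P P' : nat) (S : set 'rV[R]_D)
    (cS : compact S) (H : C1map R P P') (f : Cspace cS P) (N : nat)
    (r : 'I_N -> Cspace cS P) (s s' : S) :
  sample_cov (fun n => cfun_diff H f (r n)) s s' =
  dmx H (f s) *m sample_cov r s s' *m (dmx H (f s'))^T.
Proof.
rewrite /sample_cov /dmx trmxK -scalemxAr -scalemxAl; congr (_ *: _).
rewrite mulmx_sumr mulmx_suml; apply: eq_bigr => n _.
by rewrite !cfun_diffE trmx_mul !mulmxA.
Qed.

Lemma cfun_diff_sum0 (R : realType) (D P P' : nat) (S : set 'rV[R]_D)
    (cS : compact S) (H : C1map R P P') (f : Cspace cS P) (N : nat)
    (r : 'I_N -> Cspace cS P) :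
  \sum_(n < N) r n = 0 -> \sum_(n < N) cfun_diff H f (r n) = 0.
Proof.
move=> r0; apply: cfunP => s; rewrite cfun_sumE.
under eq_bigr do rewrite cfun_diffE.
by rewrite -mulmx_suml -cfun_sumE r0 mul0mx.
Qed.

(** Telescoping, one factor changed at a time. The perturbed factors are at most
    1 away from the original ones, which gives the bounds [K + 1] and [L + 1];
    each of the three terms is then at most [(K + 1)^2 (L + 1) eta], up to the
    two dimension factors from the matrix products. *)
Lemma sandwich_perturbation (R : realType) (P P' : nat)
    (A A0 B B0 : 'M[R]_(P', P)) (C C0 : 'M[R]_P) (K L eta : R) :
  eta <= 1 -> `|A - A0| <= eta -> `|B - B0| <= eta -> `|C - C0| <= eta ->
  `|A0| <= K -> `|B0| <= K -> `|C0| <= L ->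
  `|A *m C *m B^T - A0 *m C0 *m B0^T| <=
    P%:R * P%:R * (3 * (K + 1) * (K + 1) * (L + 1)) * eta.
Proof.
move=> eta1 Ae Be Ce A0K B0K C0L.
have eta0 : 0 <= eta by exact: le_trans Ae.
have K0 : 0 <= K by exact: le_trans A0K.
have L0 : 0 <= L by exact: le_trans C0L.
have mul3 (X Y : 'M[R]_(P', P)) (Z : 'M[R]_P) x y z :
    `|X| <= x -> `|Z| <= z -> `|Y| <= y ->
    `|X *m Z *m Y^T| <= P%:R * P%:R * (x * z * y).
  move=> Xx Zz Yy; rewrite (le_trans (mx_norm_mulmx_le _ _))// mx_norm_tr.
  rewrite -!mulrA ler_wpM2l// !mulrA ler_pM//.
  by rewrite (le_trans (mx_norm_mulmx_le _ _))// -!mulrA ler_wpM2l// ler_pM.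
have near1 m n (X X0 : 'M[R]_(m, n)) x : `|X - X0| <= eta -> `|X0| <= x ->
    `|X| <= x + 1.
  move=> Xe X0x; rewrite -(subrK X0 X) (le_trans (ler_normD _ _))// addrC.
  by rewrite lerD// (le_trans Xe).
have -> : A *m C *m B^T - A0 *m C0 *m B0^T = (A - A0) *m C *m B^T +
    (A0 *m (C - C0) *m B^T + A0 *m C0 *m (B - B0)^T).
  rewrite (raddfB (@trmx R P' P)) [A0 *m C0 *m (_ - _)]mulmxBr.
  by rewrite [A0 *m (C - C0)]mulmxBr !mulmxBl !subrKA.
rewrite (le_trans (ler_normD _ _))//.
apply: (le_trans (lerD (mul3 _ _ _ _ _ _ Ae (near1 _ _ _ _ _ Ce C0L)
  (near1 _ _ _ _ _ Be B0K)) (ler_normD _ _))).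
apply: (le_trans (lerD (lexx _) (lerD
  (mul3 _ _ _ _ _ _ A0K Ce (near1 _ _ _ _ _ Be B0K))
  (mul3 _ _ _ _ _ _ A0K C0L Be)))).
rewrite -!mulrDr -[leRHS]mulrA ler_wpM2l ?mulr_ge0//.
(* once expanded, the inequality is linear in these nonnegative monomials *)
have := mulr_ge0 eta0 K0; have := mulr_ge0 eta0 L0.
have := mulr_ge0 eta0 (mulr_ge0 K0 L0); have := mulr_ge0 eta0 (mulr_ge0 K0 K0).
have := mulr_ge0 eta0 (mulr_ge0 K0 (mulr_ge0 K0 L0)).
nra.
Qed.

(** Off the events that [thetahat_N] is far from [theta] and that the sample
    covariance of the residuals is far from [c], the perturbation estimate
    applies; both events have vanishing outer measure. Boundedness of [c] follows
    from one outcome at which it is close to a sample covariance, a bounded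
    function. *)
Lemma delta_residuals_cov (R : realType) (D P P' : nat) (S : set 'rV[R]_D)
    (cS : compact S)
    (d : nat -> measure_display) (Omega : forall N, measurableType (d N))
    (Pr : forall N, probability (Omega N) R)
    (thetahat : forall N, Omega N -> Cspace cS P) (theta : Cspace cS P)
    (H : C1map R P P') (c : S -> S -> 'M[R]_P)
    (r : forall N, 'I_N -> Omega N -> Cspace cS P) :
  (forall delta e : R, 0 < delta -> 0 < e -> \forall N \near \oo,
     ((Pr N)^*%mu [set w | (delta <= `|thetahat N w - theta|)%R] < e%:E)%E) ->
  cvg_unif_in_prob Pr (fun N w => sample_cov (fun n => r N n w)) c ->
  cvg_unif_in_prob Pr
    (fun N w => sample_cov (fun n => cfun_diff H (thetahat N w) (r N n w)))
    (fun s s' => dmx H (theta s) *m c s s' *m (dmx H (theta s'))^T).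
Proof.
move=> consistent rc eps eps0.
have cJ := @C1_continuous _ _ _ H.
have [K K0 JK] := bounded_on_range theta (W := 'M[R]_(P, P')) cJ.
have [L L0 cL] : exists2 L, 0 <= L & forall s s', `|c s s'| <= L.
  have [N [w good]] := cvg_unif_in_prob_witness rc.
  have [B rB] := sample_cov_bounded (fun n => r N n w).
  exists (1 + `|B|) => [|s s']; first by rewrite addr_ge0.
  rewrite -(subrK (sample_cov (fun n => r N n w) s s') (c s s')).
  rewrite (le_trans (ler_normD _ _))// lerD//; first by rewrite distrC; exact: good.
  exact: le_trans (rB _ _) (ler_norm _).
pose A := P%:R * P%:R * (3 * (K + 1) * (K + 1) * (L + 1)).
have A0 : 0 <= A by rewrite /A !mulr_ge0// addr_ge0// ltW.
pose eta := Num.min 1 (eps / (A + 1)).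
have eta0 : 0 < eta by rewrite lt_min ltr01 divr_gt0// ltr_wpDl.
have eta1 : eta <= 1 by rewrite ge_min lexx.
have Aeta : A * eta <= eps.
  apply: (@le_trans _ _ (A * (eps / (A + 1)))).
    by rewrite ler_wpM2l// ge_min lexx orbT.
  by rewrite mulrCA ler_piMr ?(ltW eps0)// ler_pdivrMr ?ltr_wpDl// mul1r lerDl.
have [delta d0 Jd] :=
  uniform_continuity_near_range theta (W := 'M[R]_(P, P')) cJ eta0.
apply/cvge0_leP => [N|e e0]; first exact: mu_ext_probability_ge0.
have e20 : 0 < e / 2 by rewrite divr_gt0.
have /cvge0_leP := rc eta eta0.
move=> /(_ (fun N => mu_ext_probability_ge0 _ _) _ e20).
apply: filterS2 (consistent delta (e / 2) d0 e20) => N /ltW thN rN.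
have split_bad w :
    (exists s s', eps < `|sample_cov (fun n => cfun_diff H (thetahat N w) (r N n w))
       s s' - dmx H (theta s) *m c s s' *m (dmx H (theta s'))^T|) ->
    delta <= `|thetahat N w - theta| \/
    exists s s', eta < `|sample_cov (fun n => r N n w) s s' - c s s'|.
  move=> [s [s' big]].
  have [dth|thd] := leP delta `|thetahat N w - theta|; [by left|right].
  apply: contrapT => good; move: big; apply/negP; rewrite -leNgt sample_cov_diff.
  have Jclose t : `|dmx H (thetahat N w t) - dmx H (theta t)| <= eta.
    rewrite /dmx -raddfB mx_norm_tr; apply: Jd; apply: le_lt_trans thd.
    exact: (cfun_le_norm (thetahat N w - theta) t).
  apply: le_trans Aeta; apply: sandwich_perturbation => //.
  - by rewrite leNgt; apply/negP => bad; apply: good; exists s, s'.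
  - by rewrite mx_norm_tr.
  - by rewrite mx_norm_tr.
rewrite (splitr e) EFinD; apply: le_trans (leeD thN rN).
apply: le_trans (outer_measureU2 (Pr N)^*%mu _ _).
by apply: le_mu_ext => w /split_bad.
Qed.

Theorem theorem1 (R : realType) (D P P' : nat)
    (S : set 'rV[R]_D) (cS : compact S)
    (d : nat -> measure_display) (Omega : forall N, measurableType (d N))
    (Pr : forall N, probability (Omega N) R)
    (thetahat : forall N, {RV (Pr N) >-> Cspace cS P})
    (theta : Cspace cS P)
    (d' : measure_display) (Omega' : measurableType d')
    (Pr' : probability Omega' R)
    (G : {RV Pr' >-> Cspace cS P}) (c : S -> S -> 'M[R]_P)
    (H : C1map R P P')
    (hcvg : weakly_cvg Pr
       (fun N w => Num.sqrt (N%:R : R) *: (thetahat N w - theta)) Pr' G)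
    (hG : zero_mean_gaussian_process Pr' G c) :
  let ctilde := fun s s' : S =>
    dmx H (theta s) *m c s s' *m (dmx H (theta s'))^T in
  let Gtilde := fun w => cfun_diff H theta (G w) in
  (weakly_cvg Pr
     (fun N w => Num.sqrt (N%:R : R) *:
        (cfun_comp H (thetahat N w) - cfun_comp H theta)) Pr' Gtilde /\
   zero_mean_gaussian_process Pr' Gtilde ctilde) /\
  (forall Rs : forall N, 'I_N -> {RV (Pr N) >-> Cspace cS P},
     (forall N w, \sum_(n < N) Rs N n w = 0) ->
     cvg_unif_in_prob Pr (fun N w => sample_cov (fun n => Rs N n w)) c ->
     let Rtilde := fun N (n : 'I_N) w => cfun_diff H (thetahat N w) (Rs N n w) in
     cvg_unif_in_prob Pr (fun N w => sample_cov (fun n => Rtilde N n w)) ctilde /\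
     (forall N w, \sum_(n < N) Rtilde N n w = 0)).
Proof.
move=> ctilde Gtilde; split; first split.
- exact: (delta_method H (fun N => measurable_funPT (thetahat N)) hcvg).
- exact: gaussian_cfun_diff.
- move=> Rs Rs0 Rsc Rtilde; split; last first.
    by move=> N w; exact: cfun_diff_sum0.
  have cons delta e (d0 : 0 < delta) (e0 : 0 < e) :=
    estimator_consistent hcvg d0 e0.
  exact: (@delta_residuals_cov _ _ _ _ _ _ _ _ _ _ _ H _
    (fun N n w => Rs N n w) cons Rsc).
Qed.
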